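(* Let $[\mathcal D_x]$ be the optimally accurate discrete differential operator with central stencil $L=R\ge1$, and let $\boldsymbol M$ be the associated matrix for the uniform grid with $N$ cells, $h=1/N$. There exists a constant $C$ determined by $[\mathcal D_x]$ (in particular, independent of $h$) such that both of the following hold with this same $C$, for every $N$. (a) Every solution $\boldsymbol u(t)\in\mathbb R^{2N}$ of the semi-discretized scheme $\boldsymbol u'+\frac1h\boldsymbol M\boldsymbol u=\boldsymbol 0$ satisfies $\boldsymbol u(t)\cdot\boldsymbol u(t)\le C\,\boldsymbol u(0)\cdot\boldsymbol u(0)$ for all $t\ge0$. (b) For any initial data $\boldsymbol u^0\in\mathbb R^{2N}$ and any time steps $\Delta t^n=t^{n+1}-t^n>0$, if $\boldsymbol u^n$ is the numerical solution at $t^n$ updated by the midpoint rule $$\frac{\boldsymbol u^{n+1}-\boldsymbol u^n}{\Delta t^n}+\frac1h\boldsymbol M\frac{\boldsymbol u^{n+1}+\boldsymbol u^n}{2}=\boldsymbol 0,\qquad n\ge0,$$ then for all $n>0$, $$\boldsymbol u^n\cdot\boldsymbol u^n\le C\,\boldsymbol u^0\cdot\boldsymbol u^0.$$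
   Context: Setting: the advection equation $u_t+u_x=0$ on $[0,1]$ with periodic boundary conditions, on the uniform grid $x_j=jh$, $h=1/N$. The hybrid-variable (HV) method uses approximations $u_j$ of the nodal values $u(x_j,t)$ and $\overline u_{j+1/2}$ of the cell averages $\frac1h\int_{x_j}^{x_{j+1}}u(x,t)\,dx$ (all indices $N$-periodic), collected in $\boldsymbol u=[\overline u_{1/2},\overline u_{3/2},\dots,\overline u_{N-1/2},u_0,u_1,\dots,u_{N-1}]^T$. Central stencil: $L=R\ge1$, $l'=r'=\lfloor R/2\rfloor$, $l=r=R-r'$. The discrete differential operator is $$[\mathcal D_xu]_j=\frac1h\sum_{k=-r}^{r-1}\alpha_k\overline u_{j+k+1/2}+\frac1h\sum_{k=-r'}^{r'}\beta_ku_{j+k},$$ where the real constants $\alpha_k,\beta_k$ (independent of $h$ and $j$) are the unique ones giving the optimal order of accuracy $p=L+R$. Here order $p$ means that, applied to the exact cell averages and nodal values of any sufficiently smooth $u(x)$, $[\mathcal D_xu]_j=u_x(x_j)+c_pu^{(p+1)}(x_j)h^p+O(h^{p+1})$ with $c_p\ne0$. Explicitly, with $C^{m,n}_k=\frac{m!\,n!}{(m+k)!\,(n-k)!}$, $H_k=1+\frac12+\cdots+\frac1k$, $H_0=0$, and $\zeta^{m,n}_k=H_{m+k}-H_{n-k}$: $\beta_0=0$ and $\beta_\nu=-\frac2\nu C^{r,r}_\nu C^{r',r'}_\nu$ for $0<|\nu|\le r'$; $\alpha_\nu=\sum_{k=\nu+1}^rt_k$ for $0\le\nu\le r-1$ and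 $\alpha_\nu=-\alpha_{-1-\nu}$ for $-r\le\nu<0$; where, if $r'=r$, $t_k=\frac{2(1+2k\zeta^{r,r}_k)}{k^2}[C^{r,r}_k]^2$ for $1\le k\le r$, and, if $r'=r-1$, $t_k=\frac{2(1+k(\zeta^{r,r}_k+\zeta^{r',r'}_k))}{k^2}C^{r,r}_kC^{r',r'}_k$ for $1\le k\le r-1$ and $t_r=\frac2{r^2}C^{r,r}_rC^{r-1,r}_r$. The semi-discretized scheme $\overline u_{j+1/2}'+\frac1h(u_{j+1}-u_j)=0$, $u_j'+[\mathcal D_xu]_j=0$ is $\boldsymbol u'+\frac1h\boldsymbol M\boldsymbol u=\boldsymbol0$ with $$\boldsymbol M=\begin{bmatrix}\boldsymbol0&\boldsymbol S-\boldsymbol I\\ G(\boldsymbol S)&H(\boldsymbol S)\end{bmatrix}\in\mathbb R^{2N\times2N},\quad G(z)=\sum_{k=-r}^{r-1}\alpha_kz^k,\quad H(z)=\sum_{k=-r'}^{r'}\beta_kz^k,$$ where $\boldsymbol0,\boldsymbol I$ are the $N\times N$ zero and identity matrices and $\boldsymbol S$ is the $N\times N$ cyclic shift $(\boldsymbol S\boldsymbol x)_j=x_{j+1}$ (indices modulo $N$). *)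

(* Defs.v *)
From HB Require Import structures.
From mathcomp Require Import all_boot all_order all_fingroup all_algebra.
From mathcomp Require Import all_classical all_reals all_analysis.
Set Implicit Arguments.
Unset Strict Implicit.
Unset Printing Implicit Defensive.
Import Order.TTheory GRing.Theory Num.Theory.
Import numFieldNormedType.Exports.
Local Open Scope ring_scope.
Local Open Scope classical_set_scope.

(* Central stencil with L = R = s: nodal values at offsets -r', ..., r' and   *)
(* cell averages at offsets -r, ..., r - 1, where r' = floor(s / 2) and       *)
(* r = s - r'. Coefficient families are indexed by [int]; only their values   *)
(* at the stencil offsets are ever used.                                      *)
Definition node_radius (s : nat) : nat := s./2.
Definition cell_radius (s : nat) : nat := (s - node_radius s)%N.

Definition cell_offset (s : nat) (i : 'I_(cell_radius s + cell_radius s)) : int :=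
  (i : nat)%:Z - (cell_radius s)%:Z.
Definition node_offset (s : nat) (i : 'I_(node_radius s + node_radius s).+1) : int :=
  (i : nat)%:Z - (node_radius s)%:Z.

(* [ubar j] stands for the average over the cell (x_j, x_{j+1}), that is, for *)
(* the datum with half-integer index j + 1/2.                                 *)
Definition HV_Dx (R : realType) (s : nat) (alpha beta : int -> R) (h : R)
    (ubar unode : int -> R) (j : int) : R :=
  h^-1 * (\sum_(i < cell_radius s + cell_radius s)
            alpha (cell_offset i) * ubar (j + cell_offset i))
  + h^-1 * (\sum_(i < (node_radius s + node_radius s).+1)
              beta (node_offset i) * unode (j + node_offset i)).

(* Exact data of f on the uniform grid { x + j h : j integer } through x.     *)
Definition exact_node (R : realType) (f : R -> R) (x h : R) (j : int) : R :=
  f (x + j%:~R * h).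
Definition exact_cell (R : realType) (f : R -> R) (x h : R) (j : int) : R :=
  h^-1 * \int[lebesgue_measure]_(y in `[x + j%:~R * h, x + (j + 1)%:~R * h]) f y.

Definition smooth (R : realType) (f : R -> R) : Prop :=
  forall n x, derivable (derive1n n f) x 1.

(* The error constant c is the same for all f, x and h.                       *)
Definition has_order (R : realType) (s : nat) (alpha beta : int -> R)
    (p : nat) : Prop :=
  exists2 c : R, c != 0 &
  forall f : R -> R, smooth f -> forall x : R,
  (fun h : R => HV_Dx s alpha beta h (exact_cell f x h) (exact_node f x h) 0
                - derive1 f x - c * derive1n p.+1 f x * h ^+ p)
  =O_ (0^'+) (fun h : R => h ^+ p.+1).

(* The optimal order on the stencil is L + R = 2 s.                           *)
Definition optimally_accurate (R : realType) (s : nat) (alpha beta : int -> R) :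
    Prop :=
  has_order s alpha beta (s + s).

Definition cyclic_shift (R : realType) (n : nat) : 'M[R]_n.+1 :=
  perm_mx (perm (@ordS_inj n.+1)).

Lemma cyclic_shiftE (R : realType) (n : nat) (v : 'cV[R]_n.+1) (j : 'I_n.+1) :
  (cyclic_shift R n *m v) j 0 = v (ordS j) 0.
Proof. by rewrite /cyclic_shift -row_permE mxE permE. Qed.

(* Hence the negative powers of the shift are powers of its genuine inverse.  *)
Lemma cyclic_shift_unit (R : realType) (n : nat) :
  cyclic_shift R n \is a GRing.unit.
Proof. exact: unitmx_perm. Qed.

Definition HV_G (R : realType) (s : nat) (alpha : int -> R) (n : nat)
    (S : 'M[R]_n.+1) : 'M[R]_n.+1 :=
  \sum_(i < cell_radius s + cell_radius s)
    alpha (cell_offset i) *: S ^ cell_offset i.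
Definition HV_H (R : realType) (s : nat) (beta : int -> R) (n : nat)
    (S : 'M[R]_n.+1) : 'M[R]_n.+1 :=
  \sum_(i < (node_radius s + node_radius s).+1)
    beta (node_offset i) *: S ^ node_offset i.

(* The grid has N = n.+1 cells; a state vector lists the N cell averages      *)
(* first and then the N nodal values.                                         *)
Definition HV_matrix (R : realType) (s : nat) (alpha beta : int -> R) (n : nat) :
    'M[R]_(n.+1 + n.+1) :=
  let S := cyclic_shift R n in
  block_mx 0 (S - 1) (HV_G s alpha S) (HV_H s beta S).

Definition mesh_size (R : realType) (n : nat) : R := n.+1%:R^-1.

Definition dotv (R : realType) (m : nat) (u v : 'cV[R]_m) : R :=
  \sum_(i < m) u i 0 * v i 0.

Definition semidiscrete_solution (R : realType) (s : nat)
    (alpha beta : int -> R) (n : nat) (u : R -> 'cV[R]_(n.+1 + n.+1)) : Prop :=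
  {within `[0, +oo[, continuous u} /\
  forall t : R, 0 < t -> derivable u t 1 /\
    derive1 u t + (mesh_size R n)^-1 *: (HV_matrix s alpha beta n *m u t) = 0.

Definition midpoint_solution (R : realType) (s : nat)
    (alpha beta : int -> R) (n : nat) (t : nat -> R)
    (u : nat -> 'cV[R]_(n.+1 + n.+1)) : Prop :=
  forall k : nat,
    (t k.+1 - t k)^-1 *: (u k.+1 - u k)
    + (mesh_size R n)^-1 *:
        (HV_matrix s alpha beta n *m (2^-1 *: (u k.+1 + u k))) = 0.

(* Main.v *)
Require Import Defs.
From mathcomp Require Import all_boot all_order all_algebra.
From mathcomp Require Import all_classical all_reals all_analysis.
From mathcomp Require Import zify ring lra.
Set Implicit Arguments.
Unset Strict Implicit.
Unset Printing Implicit Defensive.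
Import Order.TTheory GRing.Theory Num.Theory.
Import numFieldNormedType.Exports.
Local Open Scope classical_set_scope.
Local Open Scope ring_scope.

(** Both time evolutions conserve one and the same quadratic energy, and this
energy is equivalent to the Euclidean norm with constants that do not depend
on the grid.

Write w for the cell averages and v for the nodal values, r' <= r for the two
radii of the stencil (so r = r' or r = r' + 1, and r + r' = s), and
P_k(S) = 1 + S + ... + S^(k-1). The energy is
  E(w, v) = sum_(1 <= k <= r) t_k |P_k(S) w|^2 + |v|^2,
that is, <w, Q w> + <v, v> with Q = sum_k t_k P_k(S)^T P_k(S). It is conserved
because H(S) is skew-symmetric and G(S) = (1 - S^-1) Q, where
1 - S^-1 = -(S - 1)^T: the contributions of the blocks S - 1 and G(S) then
cancel. Since S is orthogonal, t_1 |w|^2 <= <w, Q w> <= (sum_k t_k k^2) |w|^2,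
provided that all t_k are positive.

The rest is the derivation of these facts from the order of accuracy. Let F be
a primitive of the function f to which the stencil is applied. Cell averages of
f are divided differences of F, and nodal values of f are values of F', so that
accuracy of order 2s says that
  sum_k alpha_k (F(k+1) - F(k)) + sum_k beta_k F'(k) = F''(0)
for every polynomial F of degree at most 2s + 1 (lemma stencil_defect_eq0).
These degrees are exactly those of Hermite interpolation of F at the integers
|k| <= r and of F' at the integers |k| <= r'. Testing with Hermite basis
polynomials L_k (value 1 at k, all other data 0) gives
  alpha_nu = sum_(nu < k <= r) t_k,   t_k = L_k''(0),
and testing with reflected polynomials gives the antisymmetry of alpha and beta
(lemmas cell_weights and node_weights_odd). The telescoping form of alpha is
what yields the factorization G(S) = (1 - S^-1) Q.

Finally t_k > 0. For 0 < k <= r' one has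
L_k(x) = W(x) / W(k) * (1 - (x - k) W'(k) / W(k)), where W is the product of
the x - j over all nodes j other than k, counted with multiplicity. It has a
double zero at 0, so that t_k = W''(0) / W(k) * (1 + k W'(k) / W(k)). The first
factor is positive because the two families of nodes have the same number
of points in (0, k), and W'(k) / W(k) is a sum of two differences of harmonic
numbers of the form H_(k+m) - H_(m-k), hence nonnegative. If k = r > r' the
linear factor is absent and only the sign of W''(0) / W(k) matters. *)

(** * The order conditions for polynomials *)

Lemma derive1n_horner (R : realType) (F : {poly R}) (n : nat) :
  derive1n n (horner F) = horner F^`(n).
Proof.
elim: n => [//|n IHn].
by rewrite derive1nS IHn derivnS -derivE.
Qed.

Lemma smooth_horner (R : realType) (F : {poly R}) : smooth (horner F).
Proof. by move=> n x; rewrite derive1n_horner; exact: derivable_horner. Qed.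

Lemma Rintegral_deriv_horner (R : realType) (F : {poly R}) (a b : R) :
  a < b ->
  \int[lebesgue_measure]_(y in `[a, b]) F^`().[y] = F.[b] - F.[a].
Proof.
move=> ab; rewrite /Rintegral (@continuous_FTC2 R _ (horner F)) //.
- by apply: continuous_subspaceT; exact: continuous_horner.
- split=> [x _||]; first exact: derivable_horner.
  + by apply: cvg_at_right_filter; exact: continuous_horner.
  + by apply: cvg_at_left_filter; exact: continuous_horner.
- by move=> x _; rewrite derivE.
Qed.

Lemma exact_cell_deriv (R : realType) (F : {poly R}) (h : R) (j : int) :
  0 < h ->
  exact_cell (horner F^`()) 0 h j =
  h^-1 * (F.[(j + 1)%:~R * h] - F.[j%:~R * h]).
Proof.
move=> h0; rewrite /exact_cell !add0r Rintegral_deriv_horner //.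
by rewrite ltr_pM2r // ltr_int ltrDl.
Qed.

(** The order condition on a unit grid centred at 0, written in terms of a
primitive [F] of the sampled function: the average over the cell (k, k+1) is
then [F(k+1) - F(k)]. *)
Definition stencil_defect (R : realType) (s : nat) (alpha beta : int -> R)
    (F : {poly R}) : R :=
  \sum_(i < cell_radius s + cell_radius s)
     alpha (cell_offset i) *
       (F.[(cell_offset i + 1)%:~R] - F.[(cell_offset i)%:~R])
  + \sum_(i < (node_radius s + node_radius s).+1)
     beta (node_offset i) * F^`().[(node_offset i)%:~R]
  - F^`()^`().[0].

(** A single power of h that is too low for the remainder must have coefficient 0.
The exponent m - 1 is written as [h^-1 * h ^+ m] because m may be 0. *)
Lemma bigO_small_monomial (R : realType) (f : R -> R) (c : R) (m p : nat) :
  (m <= p)%N -> (forall h, 0 < h -> f h = h^-1 * h ^+ m * c) ->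
  f =O_ (0^'+) (fun h : R => h ^+ p.+1) ->
  c = 0.
Proof.
move=> mp fE /eqO_exP[k k0 Hk]; apply/eqP; apply: contraT => c0.
suff: \forall h \near (0 : R)^'+, False by move/filter_ex => [].
near=> h.
have h0 : 0 < h by near: h; exact: nbhs_right_gt.
have h1 : h < 1 by near: h; exact: nbhs_right_lt.
have hk : h < `|c| / k.
  by near: h; apply: nbhs_right_lt; rewrite divr_gt0 // normr_gt0.
have : `|f h| <= k * `|h ^+ p.+1| by near: h; exact: Hk.
rewrite fE // !normrM normfV !normrX (gtr0_norm h0).
rewrite -ler_pdivlMl ?mulr_gt0 ?invr_gt0 ?exprn_gt0 //.
have -> : (h^-1 * h ^+ m)^-1 * (k * h ^+ p.+1) = k * (h * (h ^+ (p - m) * h)).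
  rewrite -{1}(subnKC mp) -addnS exprD exprS; field.
  by rewrite gt_eqF // gt_eqF // exprn_gt0.
apply/negP; rewrite -ltNge mulrC -ltr_pdivlMr //; apply: le_lt_trans hk.
rewrite ler_piMr // ?(ltW h0) // mulr_ile1 ?exprn_ge0 ?exprn_ile1 // ltW //.
Unshelve. all: by end_near.
Qed.

(** On a monomial every term of the stencil scales with the same power of h, and
the leading error term vanishes because the degree is at most 2s; so the
truncation error is one monomial in h, of too low an order to be nonzero. *)
Lemma stencil_defect_monomial (R : realType) (s : nat) (alpha beta : int -> R)
    (m : nat) :
  optimally_accurate s alpha beta -> (m <= s + s)%N ->
  stencil_defect s alpha beta 'X^(m.+1) = 0.
Proof.
move=> [c _ Hc] mp.
have Hm := Hc _ (@smooth_horner R ('X^(m.+1))^`()) 0.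
apply: (bigO_small_monomial mp _ Hm) => h h0.
have -> : derive1n (s + s).+1 (horner ('X^(m.+1))^`()) 0 = 0 :> R.
  rewrite derive1n_horner derivn_poly0 ?horner0 //.
  by rewrite (leq_trans (size_poly _ _)) ?size_polyXn /=.
rewrite mulr0 mul0r subr0 -derivE /HV_Dx /stencil_defect.
rewrite mulrBr mulrDr; congr (_ + _ - _).
- rewrite !mulr_sumr; apply: eq_bigr => i _.
  rewrite exact_cell_deriv // add0r !hornerXn !exprMn (exprS h); field.
  by rewrite gt_eqF.
- rewrite !mulr_sumr; apply: eq_bigr => i _.
  rewrite /exact_node !add0r derivXn !hornerMn !hornerXn /= exprMn; ring.
- rewrite derivXn derivMn derivXn /= !hornerMn !hornerXn.
  case: m mp Hm => [|[|m]] _ _; rewrite ?mulr0n ?mul0rn ?mulr0 //.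
    by rewrite expr0 expr1 mulVf ?gt_eqF // mul1r.
  by rewrite /= exprS mul0r !mul0rn mulr0.
Qed.

Lemma stencil_defect_eq0 (R : realType) (s : nat) (alpha beta : int -> R)
    (F : {poly R}) :
  optimally_accurate s alpha beta -> (size F <= (s + s).+2)%N ->
  stencil_defect s alpha beta F = 0.
Proof.
move=> Hopt sF.
have defD A B : stencil_defect s alpha beta (A + B) =
    stencil_defect s alpha beta A + stencil_defect s alpha beta B.
  rewrite /stencil_defect !derivD !hornerD.
  under eq_bigr do rewrite !hornerD opprD addrACA mulrDr.
  under [X in _ + X - _]eq_bigr do rewrite hornerD mulrDr.
  rewrite !big_split /=; ring.
have defZ c A : stencil_defect s alpha beta (c *: A) =
    c * stencil_defect s alpha beta A.
  rewrite /stencil_defect !derivZ !hornerZ mulrBr mulrDr !mulr_sumr.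
  congr (_ + _ - _); apply: eq_bigr => i _; rewrite !hornerZ; ring.
have def0 : stencil_defect s alpha beta 0 = 0.
  by rewrite -(scale0r 0) defZ mul0r.
have defC : stencil_defect s alpha beta 'X^0 = 0.
  rewrite /stencil_defect expr0 -polyC1 derivC deriv0 !horner0 subr0.
  by rewrite !big1 ?addr0 // => i _; rewrite ?horner0 ?hornerC ?subrr ?mulr0.
rewrite -[F]coefK poly_def.
apply: (big_ind (fun A => stencil_defect s alpha beta A = 0)) => //.
  by move=> A B hA hB; rewrite defD hA hB addr0.
move=> i _; rewrite defZ; case: i => [[|m] /= mF]; first by rewrite defC mulr0.
rewrite stencil_defect_monomial ?mulr0 //.
by have := leq_trans mF sF; rewrite !ltnS.
Qed.

(** * Hermite interpolation on a symmetric integer grid *)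

Fixpoint grid_points (m : nat) : seq int :=
  if m is m'.+1 then [:: m%:Z, - m%:Z & grid_points m'] else [:: 0].

Lemma mem_grid_points (m : nat) (j : int) :
  (j \in grid_points m) = (`|j| <= m)%N.
Proof.
elim: m => [|m IHm]; first by rewrite /= inE -absz_eq0 leqn0.
rewrite !in_cons IHm; lia.
Qed.

Lemma uniq_grid_points (m : nat) : uniq (grid_points m).
Proof.
elim: m => [//|m IHm].
rewrite cons_uniq in_cons !mem_grid_points cons_uniq mem_grid_points IHm; lia.
Qed.

Lemma size_grid_points (m : nat) : size (grid_points m) = (m + m).+1.
Proof. by elim: m => [//|m /= ->]; rewrite addnS. Qed.

(** The nodal polynomial of the grid -m, ..., m with the node [k] left out; for
[k] outside the grid nothing is left out. *)
Definition nodal_poly (R : nzRingType) (k : int) (m : nat) : {poly R} :=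
  \prod_(j <- grid_points m | j != k) ('X - (j%:~R)%:P).

Lemma nodal_poly_root (R : comNzRingType) (k : int) (m : nat) (j : int) :
  (`|j| <= m)%N -> j != k -> (nodal_poly R k m).[j%:~R] = 0.
Proof.
move=> jm jk; rewrite /nodal_poly (big_rem j) ?mem_grid_points //= jk.
by rewrite hornerM hornerXsubC subrr mul0r.
Qed.

Lemma nodal_poly_root0 (R : comNzRingType) (k m : nat) :
  (0 < k)%N -> (nodal_poly R k m).[0] = 0.
Proof.
move=> k0; have := @nodal_poly_root R k m 0; rewrite mulr0z; apply=> //.
by lia.
Qed.

Lemma nodal_poly_neq0 (R : numFieldType) (k : int) (m : nat) :
  (nodal_poly R k m).[k%:~R] != 0.
Proof.
rewrite /nodal_poly horner_prod prodf_seq_neq0.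
apply/allP => j _; apply/implyP => jk.
by rewrite hornerXsubC subr_eq0 eqr_int eq_sym.
Qed.

Lemma size_nodal_poly (R : comNzRingType) (k : int) (m : nat) :
  size (nodal_poly R k m) = ((m + m).+1 - (`|k| <= m)).+1.
Proof.
rewrite /nodal_poly -big_filter size_prod_XsubC size_filter.
have := count_predC (pred1 k) (grid_points m).
rewrite count_uniq_mem ?uniq_grid_points // mem_grid_points size_grid_points.
by move=> <-; rewrite addKn.
Qed.

Lemma nodal_polyS (R : comNzRingType) (k : int) (m : nat) :
  nodal_poly R k m.+1 =
  (if m.+1%:Z != k then 'X - m.+1%:R%:P else 1) *
  (if - m.+1%:Z != k then 'X + m.+1%:R%:P else 1) * nodal_poly R k m.
Proof.
rewrite /nodal_poly /= !big_cons mulrNz polyCN opprK -!pmulrn.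
by case: ifP => _; case: ifP => _; rewrite ?mul1r ?mulr1 ?mulrA.
Qed.

Lemma deriv_nodal_poly0S (R : comNzRingType) (k m : nat) :
  (0 < k)%N ->
  (nodal_poly R k m.+1)^`().[0] =
  (if m.+1 != k then - m.+1%:R else 1) * m.+1%:R * (nodal_poly R k m)^`().[0].
Proof.
move=> k0; rewrite nodal_polyS.
have -> : - m.+1%:Z != k by lia.
rewrite derivM hornerD !hornerM nodal_poly_root0 // mulr0 add0r eqz_nat.
by case: ifP => _; rewrite !hornerE ?sub0r ?add0r.
Qed.

Lemma nodal_poly_atS (R : comNzRingType) (k m : nat) :
  (0 < k)%N ->
  (nodal_poly R k m.+1).[k%:R] =
  (if m.+1 != k then k%:R - m.+1%:R else 1) * (k%:R + m.+1%:R) *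
  (nodal_poly R k m).[k%:R].
Proof.
move=> k0; rewrite nodal_polyS.
have -> : - m.+1%:Z != k by lia.
by rewrite !hornerM eqz_nat; case: ifP => _; rewrite !hornerE.
Qed.

Lemma deriv_nodal_poly0_neq0 (R : numFieldType) (k m : nat) :
  (0 < k)%N -> (nodal_poly R k m)^`().[0] != 0.
Proof.
move=> k0; elim: m => [|m IHm].
  have k_neq0 : (0 : int) != k by lia.
  rewrite /nodal_poly /= big_cons big_nil k_neq0 mulr1.
  by rewrite subr0 derivX hornerC oner_eq0.
rewrite deriv_nodal_poly0S // !mulf_neq0 ?pnatr_eq0 //.
by case: ifP; rewrite ?oppr_eq0 ?pnatr_eq0 ?oner_eq0.
Qed.

(** The sign of each quotient of the derivative at 0 by the value at k is
(-1)^(k-1) on every grid that contains 1, ..., k - 1, since only these nodes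
contribute a negative factor. The product of the two quotients is therefore
positive; the proof compares the grids m and m + 1 instead of counting signs. *)
Lemma nodal_poly_sign (R : realFieldType) (k m r : nat) :
  (0 < k <= r)%N -> (m <= r <= m.+1)%N ->
  0 < ((nodal_poly R k m)^`().[0] * (nodal_poly R k r)^`().[0]) *
      ((nodal_poly R k m).[k%:R] * (nodal_poly R k r).[k%:R]).
Proof.
move=> /andP[k0 kr] mr.
have d0 := deriv_nodal_poly0_neq0 R m k0.
have w0 := nodal_poly_neq0 R k m; rewrite -pmulrn in w0.
have sq : 0 < ((nodal_poly R k m)^`().[0]) ^+ 2 * (nodal_poly R k m).[k%:R] ^+ 2.
  by rewrite mulr_gt0 // exprn_even_gt0 //=.
have [rm|rm] : r = m \/ r = m.+1 by lia.
all: subst r.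
  by rewrite -!expr2.
rewrite deriv_nodal_poly0S // nodal_poly_atS //.
set e0 := if _ then - _ else _; set ek := if _ then _ - _ else _.
set a := _.[0] in sq *; set b := _.[_] in sq *.
have e_gt0 : 0 < e0 * ek.
  rewrite /e0 /ek; case: ifP => [neq|_]; last by rewrite mulr1.
  rewrite nmulr_rgt0 ?oppr_lt0 ?ltr0n // subr_lt0 ltr_nat.
  by move: neq; lia.
have n_gt0 : 0 < m.+1%:R * (k%:R + m.+1%:R) :> R.
  by rewrite mulr_gt0 ?addr_gt0 ?ltr0n.
have -> : a * (e0 * m.+1%:R * a) * (b * (ek * (k%:R + m.+1%:R) * b)) =
    a ^+ 2 * b ^+ 2 * (e0 * ek) * (m.+1%:R * (k%:R + m.+1%:R)) by ring.
by rewrite mulr_gt0 // mulr_gt0.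
Qed.

Definition harmonic_number (R : fieldType) (n : nat) : R :=
  \sum_(i < n) i.+1%:R^-1.

Definition nodal_logder (R : fieldType) (k : int) (m : nat) : R :=
  \sum_(j <- grid_points m | j != k) (k%:~R - j%:~R)^-1.

Lemma nodal_poly_logder (R : numFieldType) (k : int) (m : nat) :
  (nodal_poly R k m)^`().[k%:~R] =
  (nodal_poly R k m).[k%:~R] * nodal_logder R k m.
Proof.
rewrite /nodal_poly /nodal_logder.
elim: (grid_points m) => [|j s IHs].
  by rewrite !big_nil derivC horner0 mulr0.
rewrite !big_cons; case: ifP => // jk.
have kj : k%:~R - j%:~R != 0 :> R by rewrite subr_eq0 eqr_int eq_sym jk.
by rewrite derivM derivXsubC mul1r hornerD !hornerM IHs hornerXsubC; field.
Qed.

(** The sum of 1 / (k - j) runs over consecutive integers k - j, from k + m down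
to k - m. If the range avoids 0 (m < k) it is a difference of harmonic numbers;
otherwise the omitted j = k splits it into a positive and a negative part. *)
Lemma nodal_logderE (R : numFieldType) (k m : nat) :
  (0 < k)%N ->
  nodal_logder R k m =
  harmonic_number R (k + m) -
  harmonic_number R (if (m < k)%N then k - m.+1 else m - k)%N.
Proof.
move=> k0; elim: m => [|m IHm].
  case: k k0 => // k _; rewrite /nodal_logder /= big_cons big_nil.
  rewrite subr0 addr0 addn0 subn1 /= /harmonic_number big_ord_recr /=.
  by rewrite [RHS]addrC addKr -pmulrn.
move: IHm; rewrite /nodal_logder /= !big_cons eqz_nat.
have -> : - m.+1%:Z != k by lia.
move=> ->; rewrite -!pmulrn mulrNz opprK -pmulrn addnS.
rewrite [harmonic_number R (k + m).+1]/harmonic_number big_ord_recr /=.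
rewrite -/(harmonic_number R (k + m)) -natrD addnS.
have [mk|km|<-] := ltngtP m.+1 k => /=.
- have -> : (k - m.+1 = (k - m.+2).+1)%N by lia.
  rewrite [harmonic_number R (k - m.+2).+1]/harmonic_number big_ord_recr /=.
  rewrite -/(harmonic_number R (k - m.+2)).
  have -> : (k - m.+2).+1%:R = k%:R - m.+1%:R :> R.
    by rewrite -natrB 1?ltnW //; congr _%:R; lia.
  ring.
- have -> : (m.+1 - k = (m - k).+1)%N by lia.
  rewrite [harmonic_number R (m - k).+1]/harmonic_number big_ord_recr /=.
  rewrite -/(harmonic_number R (m - k)).
  have -> : k%:R - m.+1%:R = - (m - k).+1%:R :> R.
    by rewrite -opprB -natrB 1?ltnW //; congr (- _%:R); lia.
  rewrite invrN; ring.
- by rewrite subnn; ring.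
Qed.

Lemma nodal_logder_ge0 (R : numFieldType) (k m : nat) :
  (0 < k)%N -> 0 <= nodal_logder R k m.
Proof.
move=> k0; rewrite nodal_logderE // subr_ge0.
set n := (X in harmonic_number R X <= _).
have nkm : (n <= k + m)%N by rewrite /n; case: ifP; lia.
rewrite -(subnKC nkm) [X in _ <= X]/harmonic_number big_split_ord /=.
by rewrite lerDl sumr_ge0 // => i _; rewrite invr_ge0 ler0n.
Qed.

(** The Hermite basis polynomial attached to the value at the node k. When k is
also a node for the derivative, a linear factor corrects the slope at k; its
value at 0 is at least 1 because the logarithmic derivatives of both nodal
polynomials are nonnegative at k. When k = r = m + 1 the slope at k is free, and
the linear factor must be absent for the degree to stay within bounds. *)
Lemma hermite_value_poly (R : realFieldType) (k m r : nat) :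
  (0 < k <= r)%N -> (m <= r <= m.+1)%N ->
  exists F : {poly R},
    [/\ (size F <= (m + r + (m + r)).+2)%N,
        forall j : int, (`|j| <= r)%N -> F.[j%:~R] = (j == k)%:R,
        forall j : int, (`|j| <= m)%N -> F^`().[j%:~R] = 0 &
        0 < F^`()^`().[0]].
Proof.
move=> /andP[k0 kr] mr.
set wm := nodal_poly R k m; set wr := nodal_poly R k r.
set sigma : R := if (k <= m)%N then nodal_logder R k m + nodal_logder R k r else 0.
pose l : {poly R} := 1 - sigma *: ('X - k%:R%:P).
pose c : R := (wm.[k%:R] * wr.[k%:R])^-1.
have wm0 : wm.[k%:R] != 0 by have := nodal_poly_neq0 R k m; rewrite -pmulrn.
have wr0 : wr.[k%:R] != 0 by have := nodal_poly_neq0 R k r; rewrite -pmulrn.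
have lk : l.[k%:R] = 1 by rewrite !hornerE subrr mulr0 subr0.
have dl x : l^`().[x] = - sigma.
  by rewrite /l derivB derivZ derivXsubC derivC !hornerE.
exists (c *: (wm * wr * l)); split.
- apply: leq_trans (size_scale_leq _ _) _.
  apply: leq_trans (size_polyMleq _ _) _.
  have := size_polyMleq wm wr; rewrite !size_nodal_poly /=.
  have : (size l <= (k <= m).+1)%N.
    rewrite /l /sigma; case: ifP => _; last by rewrite scale0r subr0 size_poly1.
    apply: leq_trans (size_polyD _ _) _.
    rewrite size_poly1 size_polyN geq_max /=.
    by apply: leq_trans (size_scale_leq _ _) _; rewrite size_XsubC.
  rewrite kr; case: (leqP k m) => /= km;
    move: (size l) (size (wm * wr)) mr km kr; clear; lia.
- move=> j jr; rewrite hornerZ !hornerM; have [->|jk] := eqVneq j k%:Z.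
    by rewrite -!pmulrn lk mulr1 mulVf // mulf_neq0.
  by rewrite (nodal_poly_root _ jr jk) mulr0 mul0r mulr0.
- move=> j jm; have jr : (`|j| <= r)%N by lia.
  rewrite derivZ hornerZ !derivM hornerD !hornerM hornerD !hornerM dl.
  have [jk|jk] := eqVneq j k%:Z.
    have km : (k <= m)%N by lia.
    rewrite jk !nodal_poly_logder -!pmulrn lk /sigma km -/wm -/wr; ring.
  rewrite (nodal_poly_root _ jr jk) (nodal_poly_root _ jm jk); ring.
- have wm_0 : wm.[0] = 0 by exact: nodal_poly_root0.
  have wr_0 : wr.[0] = 0 by exact: nodal_poly_root0.
  have -> : (c *: (wm * wr * l))^`()^`().[0] =
      2 * c * (wm^`().[0] * wr^`().[0]) * l.[0].
    rewrite !(derivZ, derivM, derivD) !(hornerZ, hornerD, hornerM) wm_0 wr_0; ring.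
  have l0 : 0 < l.[0].
    have -> : l.[0] = 1 + sigma * k%:R by rewrite !hornerE; ring.
    rewrite ltr_pwDl // mulr_ge0 ?ler0n //.
    by rewrite /sigma; case: ifP => // _; rewrite addr_ge0 ?nodal_logder_ge0.
  rewrite mulr_gt0 // -mulrA mulr_gt0 // /c.
  have := nodal_poly_sign R (introT andP (conj k0 kr)) mr; rewrite -/wm -/wr.
  set p := wm.[_] * wr.[_]; have p0 : p != 0 by rewrite mulf_neq0.
  (* dividing by p and multiplying by p have the same effect on the sign *)
  have -> : forall q : R, p^-1 * q = q * p / p ^+ 2 by move=> q; field.
  by move=> ?; rewrite divr_gt0 // exprn_even_gt0.
Qed.

(** The Hermite basis polynomial attached to the derivative at the node k: the
nodal polynomials of both grids with one factor [X - k] restored. *)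
Lemma hermite_slope_poly (R : realFieldType) (k m r : nat) :
  (k <= m)%N -> (m <= r)%N ->
  exists F : {poly R},
    [/\ (size F <= (m + r + (m + r)).+2)%N,
        forall j : int, (`|j| <= r)%N -> F.[j%:~R] = 0 &
        forall j : int, (`|j| <= m)%N -> F^`().[j%:~R] = (j == k)%:R].
Proof.
move=> km mr.
set wm := nodal_poly R k m; set wr := nodal_poly R k r.
pose c : R := (wm.[k%:R] * wr.[k%:R])^-1.
have wm0 : wm.[k%:R] != 0 by have := nodal_poly_neq0 R k m; rewrite -pmulrn.
have wr0 : wr.[k%:R] != 0 by have := nodal_poly_neq0 R k r; rewrite -pmulrn.
exists (c *: (wm * wr * ('X - k%:R%:P))); split.
- apply: leq_trans (size_scale_leq _ _) _.
  apply: leq_trans (size_polyMleq _ _) _.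
  have := size_polyMleq wm wr; rewrite !size_nodal_poly /= size_XsubC km (leq_trans km mr).
  move: (size (wm * wr)); clear; lia.
- move=> j jr; rewrite hornerZ !hornerM hornerXsubC; have [->|jk] := eqVneq j k%:Z.
    by rewrite -!pmulrn subrr !mulr0.
  by rewrite (nodal_poly_root _ jr jk) mulr0 mul0r mulr0.
- move=> j jm; have jr : (`|j| <= r)%N by lia.
  rewrite derivZ hornerZ !derivM derivXsubC !(hornerXsubC, hornerC, hornerD, hornerM).
  have [->|jk] := eqVneq j k%:Z.
    by rewrite -!pmulrn subrr mulr0 add0r mulr1 mulVf // mulf_neq0.
  rewrite (nodal_poly_root _ jr jk) (nodal_poly_root _ jm jk) /=; ring.
Qed.

(** * Structure and signs of the stencil weights *)

Lemma sum_cell_offset_eq (R : realType) (s : nat) (alpha : int -> R) (nu : int) :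
  - (cell_radius s)%:Z <= nu < (cell_radius s)%:Z ->
  \sum_(i < cell_radius s + cell_radius s)
     alpha (cell_offset i) * (cell_offset i == nu)%:R = alpha nu.
Proof.
set r := cell_radius s => nur.
have lt_i : (`|(nu + r%:Z)%R| < r + r)%N by lia.
have offE : cell_offset (s := s) (Ordinal lt_i) = nu.
  by rewrite /cell_offset /= -/r; lia.
rewrite (bigD1 (Ordinal lt_i)) //= offE eqxx mulr1 big1 ?addr0 // => i ni.
case: eqP => [Ei|_]; last by rewrite mulr0.
case/eqP: ni; apply: val_inj => /=; move: Ei; rewrite /cell_offset -/r; lia.
Qed.

Lemma sum_node_offset_eq (R : realType) (s : nat) (beta : int -> R) (nu : int) :
  (`|nu| <= node_radius s)%N ->
  \sum_(i < (node_radius s + node_radius s).+1)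
     beta (node_offset i) * (node_offset i == nu)%:R = beta nu.
Proof.
set m := node_radius s => num.
have lt_i : (`|(nu + m%:Z)%R| < (m + m).+1)%N by lia.
have offE : node_offset (s := s) (Ordinal lt_i) = nu.
  by rewrite /node_offset /= -/m; lia.
rewrite (bigD1 (Ordinal lt_i)) //= offE eqxx mulr1 big1 ?addr0 // => i ni.
case: eqP => [Ei|_]; last by rewrite mulr0.
case/eqP: ni; apply: val_inj => /=; move: Ei; rewrite /node_offset -/m; lia.
Qed.

(** The defect depends on [F] only through its Hermite data, apart from F''(0). *)
Lemma stencil_defect_data (R : realType) (s : nat) (alpha beta phi psi : int -> R)
    (F : {poly R}) :
  (forall j : int, (`|j| <= cell_radius s)%N -> F.[j%:~R] = phi j) ->
  (forall j : int, (`|j| <= node_radius s)%N -> F^`().[j%:~R] = psi j) ->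
  stencil_defect s alpha beta F =
  \sum_(i < cell_radius s + cell_radius s)
     alpha (cell_offset i) * (phi (cell_offset i + 1) - phi (cell_offset i))
  + \sum_(i < (node_radius s + node_radius s).+1)
     beta (node_offset i) * psi (node_offset i)
  - F^`()^`().[0].
Proof.
move=> Fphi Fpsi; rewrite /stencil_defect.
congr (_ + _ - _); apply: eq_bigr => i _.
  by rewrite !Fphi //; have := ltn_ord i; rewrite /cell_offset; lia.
by rewrite Fpsi //; have := ltn_ord i; rewrite /node_offset; lia.
Qed.

Lemma stencil_radii (s : nat) :
  (1 <= s)%N ->
  [/\ (0 < cell_radius s)%N,
      (node_radius s <= cell_radius s <= (node_radius s).+1)%N &
      (node_radius s + cell_radius s = s)%N].
Proof.
rewrite /cell_radius /node_radius => s1.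
have := odd_double_half s; rewrite -muln2; case: (odd s) => /=; split; lia.
Qed.

Lemma deriv_comp_opp (R : comNzRingType) (F : {poly R}) (x : R) :
  ((F \Po (- 'X))^`().[x] = - F^`().[- x]) /\
  ((F \Po (- 'X))^`()^`().[x] = F^`()^`().[- x]).
Proof.
have compE (q : {poly R}) : (q \Po (- 'X))^`() = - (q^`() \Po (- 'X)).
  by rewrite deriv_comp derivN derivX mulrN1.
rewrite compE derivN compE opprK hornerN !horner_comp hornerN hornerX; split=> //.
Qed.

Lemma deriv_sum (R : comNzRingType) (I : Type) (r : seq I) (P : pred I)
    (F : I -> {poly R}) :
  (\sum_(i <- r | P i) F i)^`() = \sum_(i <- r | P i) (F i)^`().
Proof. exact: (big_morph _ (@derivD R) (deriv0 R)). Qed.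

(** The test polynomial is K - K(-x), with K the Hermite polynomial for the slope
at k. It is odd, so F''(0) = 0, its values vanish at all nodes, and its slopes
select exactly the weights at k and -k. *)
Lemma node_weights_odd (R : realType) (s : nat) (alpha beta : int -> R) (k : nat) :
  (1 <= s)%N -> optimally_accurate s alpha beta -> (k <= node_radius s)%N ->
  beta (- k%:Z) = - beta k.
Proof.
move=> s1 Hopt km; have [_ /andP[mr _] mrs] := stencil_radii s1.
have [K [sK K0 K1]] := hermite_slope_poly R km mr.
pose F := K - (K \Po (- 'X)).
have F0 (j : int) : (`|j| <= cell_radius s)%N -> F.[j%:~R] = 0.
  move=> jr; rewrite /F hornerD hornerN horner_comp hornerN hornerX -mulrNz.
  by rewrite !K0 ?subr0 // abszN.
have F1 (j : int) : (`|j| <= node_radius s)%N ->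
    F^`().[j%:~R] = (j == k)%:R + (j == - k%:Z)%:R.
  move=> jm; rewrite /F derivB hornerD hornerN (deriv_comp_opp _ _).1 opprK -mulrNz.
  by rewrite !K1 ?abszN // eqr_oppLR.
have F2 : F^`()^`().[0] = 0.
  by rewrite /F !derivB hornerD hornerN (deriv_comp_opp _ _).2 oppr0 subrr.
have sF : (size F <= (s + s).+2)%N.
  rewrite mrs in sK; apply: leq_trans (size_polyD _ _) _.
  rewrite size_polyN geq_max sK /= (leq_trans (size_comp_poly_leq _ _)) //.
  by rewrite size_polyN size_polyX muln1; move: sK; case: (size K).
have := stencil_defect_eq0 Hopt sF.
rewrite (stencil_defect_data alpha beta F0 F1) F2 subr0.
rewrite big1 => [|i _]; last by rewrite subrr mulr0.
rewrite add0r.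
under eq_bigr do rewrite mulrDr.
rewrite big_split /= !sum_node_offset_eq ?abszN // => /eqP.
by rewrite addrC addr_eq0 => /eqP.
Qed.

(** Adding up Hermite basis polynomials with indices above [nu] interpolates a
step function, whose forward difference is concentrated at [nu]. *)
Lemma sum_nat_eq (R : nzRingType) (nu r : nat) (j : int) :
  (`|j| <= r)%N ->
  \sum_(nu.+1 <= k < r.+1) (j == k%:Z)%:R = (nu%:Z < j)%R%:R :> R.
Proof.
move=> jr; case: ltP => [ltj|lej].
  rewrite (bigD1_seq `|j|%N) ?iota_uniq //=; last by rewrite mem_index_iota; lia.
  rewrite (_ : j == `|j|%N%:Z); last by lia.
  rewrite big1 ?addr0 // => k nk; case: eqP => // jk; move: nk; rewrite jk absz_nat.
  by rewrite eqxx.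
rewrite big_nat_cond big1 // => k /andP[/andP[nuk _] _].
by rewrite (_ : (j == k%:Z) = false) //; lia.
Qed.

(** The test polynomial F is the sum of the Hermite polynomials L_k over k > nu.
Its values form a step, so that the differences F(j+1) - F(j) single out
alpha_nu; the order condition then reads alpha_nu = F''(0). The reflection
-F(-x) has its step at -1 - nu and the opposite second derivative. *)
Lemma cell_weights (R : realType) (s : nat) (alpha beta : int -> R) :
  (1 <= s)%N -> optimally_accurate s alpha beta ->
  exists2 t : nat -> R,
    forall k, (0 < k <= cell_radius s)%N -> 0 < t k &
    forall nu, (nu < cell_radius s)%N ->
      alpha nu = \sum_(nu.+1 <= k < (cell_radius s).+1) t k /\
      alpha (- 1 - nu%:Z) = - alpha nu.
Proof.
move=> s1 Hopt; have [r0 mr mrs] := stencil_radii s1.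
have /choice[L HL] : forall k : nat, exists F : {poly R},
    (0 < k <= cell_radius s)%N ->
    [/\ (size F <= (s + s).+2)%N,
        forall j : int, (`|j| <= cell_radius s)%N -> F.[j%:~R] = (j == k)%:R,
        forall j : int, (`|j| <= node_radius s)%N -> F^`().[j%:~R] = 0 &
        0 < F^`()^`().[0]].
  move=> k; have [kr|_] := boolP (0 < k <= cell_radius s)%N; last by exists 0.
  by have [F HF] := hermite_value_poly R kr mr; rewrite mrs in HF; exists F.
exists (fun k => (L k)^`()^`().[0]) => [k /HL[]//|nu nur].
pose F := \sum_(nu.+1 <= k < (cell_radius s).+1) L k.
have HLF (k : nat) : (nu < k < (cell_radius s).+1)%N -> (0 < k <= cell_radius s)%N.
  by lia.
have F0 (j : int) : (`|j| <= cell_radius s)%N -> F.[j%:~R] = (nu%:Z < j)%R%:R.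
  move=> jr; rewrite /F horner_sum -(sum_nat_eq R nu jr).
  by apply: eq_big_nat => k /HLF/HL[_ -> //].
have F1 (j : int) : (`|j| <= node_radius s)%N -> F^`().[j%:~R] = 0.
  move=> jr; rewrite /F deriv_sum horner_sum big_nat big1 // => k /HLF/HL[_ _ -> //].
have F2 : F^`()^`().[0] = \sum_(nu.+1 <= k < (cell_radius s).+1) (L k)^`()^`().[0].
  by rewrite /F !deriv_sum horner_sum.
have sF : (size F <= (s + s).+2)%N.
  rewrite /F big_nat; apply: (big_ind (fun p : {poly R} => size p <= _)%N).
  - by rewrite size_poly0.
  - by move=> p q sp sq; rewrite (leq_trans (size_polyD _ _)) // geq_max sp.
  - by move=> k /HLF/HL[].
have aE : alpha nu = F^`()^`().[0].
  have := stencil_defect_eq0 Hopt sF.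
  rewrite (stencil_defect_data alpha beta F0 F1).
  rewrite [X in _ + X - _]big1 ?addr0; last by move=> i _; rewrite mulr0.
  rewrite -(@sum_cell_offset_eq R s alpha nu); last by lia.
  move=> /eqP; rewrite subr_eq0 => /eqP <-; apply: eq_bigr => i _; congr (_ * _).
  by case: (ltgtP (cell_offset i) nu%:Z) => h;
    case: (ltP nu%:Z (cell_offset i + 1)) => h'; rewrite ?subr0 ?subrr //; lia.
split; first by rewrite aE F2.
(* the reflected step, which is located between -1 - nu and -nu *)
pose N := - (F \Po (- 'X)).
have N0 (j : int) : (`|j| <= cell_radius s)%N -> N.[j%:~R] = - (nu%:Z < - j)%R%:R.
  move=> jr; rewrite /N hornerN horner_comp hornerN hornerX -mulrNz.
  by rewrite F0 // abszN.
have N1 (j : int) : (`|j| <= node_radius s)%N -> N^`().[j%:~R] = 0.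
  by move=> jm; rewrite /N derivN hornerN (deriv_comp_opp _ _).1 opprK -mulrNz F1 ?abszN.
have N2 : N^`()^`().[0] = - alpha nu.
  by rewrite aE /N !derivN hornerN (deriv_comp_opp _ _).2 oppr0.
have sN : (size N <= (s + s).+2)%N.
  rewrite size_polyN (leq_trans (size_comp_poly_leq _ _)) //.
  by rewrite size_polyN size_polyX muln1; move: sF; case: (size F).
have := stencil_defect_eq0 Hopt sN.
rewrite (stencil_defect_data alpha beta N0 N1) N2.
rewrite [X in _ + X - _]big1 ?addr0; last by move=> i _; rewrite mulr0.
rewrite -(@sum_cell_offset_eq R s alpha (- 1 - nu%:Z)); last by lia.
move=> /eqP; rewrite subr_eq0 => /eqP <-; apply: eq_bigr => i _; congr (_ * _).
rewrite opprK opprD.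
by case: (ltgtP (cell_offset i) (- 1 - nu%:Z)) => h;
  case: (ltP nu%:Z (- cell_offset i)) => h1;
  case: (ltP nu%:Z (- cell_offset i - 1)) => h2;
  rewrite ?subr0 ?subrr ?oppr0 ?add0r ?addNr //; lia.
Qed.

(** * Conservation of quadratic energies *)

Lemma dotvE (R : realType) (m : nat) (u v : 'cV[R]_m) :
  dotv u v = (u^T *m v) 0 0.
Proof. by rewrite !mxE; apply: eq_bigr => i _; rewrite mxE. Qed.

Lemma dotvC (R : realType) (m : nat) (u v : 'cV[R]_m) : dotv u v = dotv v u.
Proof. by apply: eq_bigr => i _; rewrite mulrC. Qed.

Lemma dotvDl (R : realType) (m : nat) (u v w : 'cV[R]_m) :
  dotv (u + v) w = dotv u w + dotv v w.
Proof. by rewrite !dotvE linearD mulmxDl mxE. Qed.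

Lemma dotvDr (R : realType) (m : nat) (u v w : 'cV[R]_m) :
  dotv u (v + w) = dotv u v + dotv u w.
Proof. by rewrite !dotvE mulmxDr mxE. Qed.

Lemma dotvZl (R : realType) (m : nat) (a : R) (u v : 'cV[R]_m) :
  dotv (a *: u) v = a * dotv u v.
Proof. by rewrite !dotvE linearZ -scalemxAl mxE. Qed.

Lemma dotvZr (R : realType) (m : nat) (a : R) (u v : 'cV[R]_m) :
  dotv u (a *: v) = a * dotv u v.
Proof. by rewrite dotvC dotvZl dotvC. Qed.

Lemma dotvNl (R : realType) (m : nat) (u v : 'cV[R]_m) :
  dotv (- u) v = - dotv u v.
Proof. by rewrite -scaleN1r dotvZl mulN1r. Qed.

Lemma dotvNr (R : realType) (m : nat) (u v : 'cV[R]_m) :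
  dotv u (- v) = - dotv u v.
Proof. by rewrite dotvC dotvNl dotvC. Qed.

Lemma dotv_suml (R : realType) (m : nat) (I : Type) (r : seq I) (P : pred I)
    (F : I -> 'cV[R]_m) (v : 'cV[R]_m) :
  dotv (\sum_(i <- r | P i) F i) v = \sum_(i <- r | P i) dotv (F i) v.
Proof.
apply: (big_morph (fun u => dotv u v)) => [a b|]; first exact: dotvDl.
by rewrite -(scale0r 0) dotvZl mul0r.
Qed.

Lemma dotv_sumr (R : realType) (m : nat) (I : Type) (r : seq I) (P : pred I)
    (F : I -> 'cV[R]_m) (v : 'cV[R]_m) :
  dotv v (\sum_(i <- r | P i) F i) = \sum_(i <- r | P i) dotv v (F i).
Proof. by rewrite dotvC dotv_suml; apply: eq_bigr => i _; rewrite dotvC. Qed.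

Lemma dotv_mulmxl (R : realType) (m p : nat) (A : 'M[R]_(m, p))
    (u : 'cV[R]_p) (v : 'cV[R]_m) :
  dotv (A *m u) v = dotv u (A^T *m v).
Proof. by rewrite !dotvE trmx_mul mulmxA. Qed.

Lemma dotv_ge0 (R : realType) (m : nat) (u : 'cV[R]_m) : 0 <= dotv u u.
Proof. by apply: sumr_ge0 => i _; rewrite -expr2 sqr_ge0. Qed.

Lemma dotv_col_mx (R : realType) (m p : nat) (u v : 'cV[R]_m) (w x : 'cV[R]_p) :
  dotv (col_mx u w) (col_mx v x) = dotv u v + dotv w x.
Proof. by rewrite !dotvE tr_col_mx mul_row_col mxE. Qed.

Lemma dotv_le_avg (R : realType) (m : nat) (u v : 'cV[R]_m) :
  dotv u v <= (dotv u u + dotv v v) / 2.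
Proof.
have := dotv_ge0 (u - v).
rewrite dotvDl !dotvDr !dotvNl !dotvNr (dotvC v u); lra.
Qed.

Section Conservation.
Variables (R : realType) (m : nat) (M P : 'M[R]_m) (c : R).
Hypothesis symP : P^T = P.
Hypothesis MP0 : forall x : 'cV[R]_m, dotv (M *m x) (P *m x) = 0.

(** The difference of the energies is twice the pairing of v - u with P applied to
the average of u and v, and the scheme makes v - u a multiple of M applied to
that same average. *)
Lemma midpoint_energy (d : R) (u v : 'cV[R]_m) :
  d != 0 -> d^-1 *: (v - u) + c *: (M *m (2^-1 *: (v + u))) = 0 ->
  dotv v (P *m v) = dotv u (P *m u).
Proof.
move=> d0 /eqP; rewrite addr_eq0 -scalerN => /eqP Hd.
have vu : v - u = d *: (c *: - (M *m (2^-1 *: (v + u)))).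
  by rewrite -Hd scalerA mulfV // scale1r.
have : dotv (v - u) (P *m (2^-1 *: (v + u))) = 0.
  by rewrite vu !dotvZl dotvNl MP0 oppr0 !mulr0.
rewrite -scalemxAr mulmxDr dotvZr !dotvDl !dotvDr !dotvNl.
have -> : dotv u (P *m v) = dotv v (P *m u).
  by rewrite dotvC dotv_mulmxl symP.
lra.
Qed.

Lemma is_derive_quadratic (u : R -> 'cV[R]_m) (x : R) (du : 'cV[R]_m) :
  derivable u x 1 -> derive1 u x = du ->
  is_derive x 1 (fun t => dotv (u t) (P *m u t)) (2 * dotv du (P *m u x)).
Proof.
move=> du_x duE.
have comp i : is_derive x (1 : R) (fun t => u t i 0) (du i 0).
  apply: DeriveDef; first by move/derivable_mxP: du_x; apply.
  by rewrite -duE derive1E derive_mx // mxE.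
have -> : (fun t => dotv (u t) (P *m u t)) =
    \sum_(i < m) \sum_(j < m) (P i j \*: ((fun t => u t i 0) * (fun t => u t j 0))).
  apply/funext => t; rewrite fct_sumE /dotv; apply: eq_bigr => i _.
  rewrite fct_sumE mxE mulr_sumr; apply: eq_bigr => j _ /=.
  exact: mulrCA.
apply: is_derive_eq.
have sw : dotv (u x) (P *m du) = dotv du (P *m u x).
  by rewrite dotvC dotv_mulmxl symP.
transitivity (dotv du (P *m u x) + dotv (u x) (P *m du)); last by rewrite sw; ring.
rewrite /dotv -big_split /=; apply: eq_bigr => i _.
rewrite !mxE !mulr_sumr -big_split /=; apply: eq_bigr => j _.
rewrite /GRing.scale /=; ring.
Qed.

Lemma continuous_quadratic : continuous (fun v : 'cV[R]_m => dotv v (P *m v)).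
Proof.
have -> : (fun v : 'cV[R]_m => dotv v (P *m v)) =
    (fun v => \sum_(i < m) \sum_(j < m) P i j * (v i 0 * v j 0)).
  apply/funext => v; rewrite /dotv; apply: eq_bigr => i _.
  by rewrite mxE mulr_sumr; apply: eq_bigr => j _; ring.
apply: continuous_big => [|i _]; first exact: add_continuous.
apply: continuous_big => [|j _]; first exact: add_continuous.
move=> v; apply: (@continuousM R 'cV[R]_m (fun=> P i j)
                                (fun v => v i 0 * v j 0)).
  exact: cst_continuous.
apply: (@continuousM R 'cV[R]_m (fun v => v i 0) (fun v => v j 0)).
  exact: (@coord_continuous R m 1 i 0 v).
exact: (@coord_continuous R m 1 j 0 v).
Qed.

(** The energy has derivative 0 for positive times and is continuous up to time 0,
so the mean value theorem applies on [0, t] without differentiability at 0. *)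
Lemma flow_energy (u : R -> 'cV[R]_m) :
  {within `[0, +oo[, continuous u} ->
  (forall t, 0 < t -> derivable u t 1 /\ derive1 u t + c *: (M *m u t) = 0) ->
  forall t, 0 <= t -> dotv (u t) (P *m u t) = dotv (u 0) (P *m u 0).
Proof.
move=> cu du t t0.
have [||x _] := @MVT_segment R (fun t => dotv (u t) (P *m u t)) (fun=> 0) 0 t t0.
- move=> x; rewrite in_itv /= => /andP[x0 _]; have [dux Ex] := du x x0.
  have -> : 0 = 2 * dotv (- (c *: (M *m u x))) (P *m u x) :> R.
    by rewrite dotvNl dotvZl MP0 mulr0 oppr0 mulr0.
  by apply: is_derive_quadratic => //; apply/eqP; rewrite -addr_eq0 Ex.
- have cu' : {within `[0, t], continuous u}.
    apply: continuous_subspaceW cu => x /=; rewrite !in_itv /= => /andP[-> _] //.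
  by move=> x; exact: (continuous_comp (cu' x) (@continuous_quadratic (u x))).
- by rewrite mul0r => /eqP; rewrite subr_eq0 => /eqP.
Qed.

End Conservation.

(** * The symmetrizer of the scheme *)

Lemma trmx_expr (R : comNzRingType) (n k : nat) (A : 'M[R]_n.+1) :
  (A ^+ k)^T = A^T ^+ k.
Proof.
elim: k => [|k IHk]; first exact: trmx1.
by rewrite exprS exprSr -mulmxE trmx_mul IHk.
Qed.

Section CyclicShift.
Variables (R : realType) (n : nat).
Let S := cyclic_shift R n.

Lemma tr_cyclic_shift : S^T = S^-1.
Proof. by rewrite /S /cyclic_shift tr_perm_mx perm_mxV. Qed.

Lemma tr_cyclic_shift_exprz (j : int) : (S ^ j)^T = S ^ (- j).
Proof.
case: j => k; first by rewrite -exprnP trmx_expr tr_cyclic_shift exprVn exprnN.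
by rewrite NegzE opprK -exprnN -exprVn -tr_cyclic_shift trmx_expr trmxK.
Qed.

Lemma dotv_cyclic_shift (k : nat) (w : 'cV[R]_n.+1) :
  dotv (S ^+ k *m w) (S ^+ k *m w) = dotv w w.
Proof.
rewrite dotv_mulmxl mulmxA trmx_expr tr_cyclic_shift mulmxE exprVn mulVr ?mul1mx //.
by rewrite unitrX // cyclic_shift_unit.
Qed.

Definition shift_sum (k : nat) : 'M[R]_n.+1 := \sum_(i < k) S ^+ i.

(** The operator is a sum of k isometries. *)
Lemma dotv_shift_sum (k : nat) (w : 'cV[R]_n.+1) :
  dotv (shift_sum k *m w) (shift_sum k *m w) <= k%:R ^+ 2 * dotv w w.
Proof.
rewrite /shift_sum mulmx_suml dotv_suml.
have -> : k%:R ^+ 2 * dotv w w = \sum_(i < k) \sum_(j < k) dotv w w.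
  by rewrite !sumr_const !card_ord -mulrnA -[RHS]mulr_natl natrM expr2.
apply: ler_sum => i _; rewrite dotv_sumr; apply: ler_sum => j _.
apply: le_trans (dotv_le_avg _ _) _; rewrite !dotv_cyclic_shift; lra.
Qed.

(** Both geometric sums telescope: 1 - S^-1 times the transposed sum is 1 - S^(-k),
and the remaining factor spreads this over k consecutive powers. *)
Lemma shift_sum_telescope (k : nat) :
  (1 - S^-1) * ((shift_sum k)^T * shift_sum k) =
  \sum_(i < k) (S ^ i%:Z - S ^ (- 1 - i%:Z)).
Proof.
have uS : S \is a GRing.unit by exact: cyclic_shift_unit.
have trE : (shift_sum k)^T = \sum_(i < k) S^-1 ^+ i.
  rewrite /shift_sum linear_sum; apply: eq_bigr => i _.
  by rewrite /= trmx_expr tr_cyclic_shift.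
have -> : 1 - S^-1 = - (S^-1 - 1) by rewrite opprB.
rewrite mulrA trE mulNr -subrX1 opprB mulrBl mul1r sumrB; congr (_ - _).
rewrite /shift_sum mulr_sumr (reindex_inj rev_ord_inj) /=.
apply: eq_bigr => i _; rewrite !exprnP exprz_inv -exprzDr //; congr (_ ^ _).
have := ltn_ord i; lia.
Qed.

(** The matrix Q for which w -> <w, Q w> is the cell part of the conserved energy;
a sum of squares, so positivity is visible from the weights. *)
Definition symmetrizer (r : nat) (t : nat -> R) : 'M[R]_n.+1 :=
  \sum_(1 <= k < r.+1) t k *: ((shift_sum k)^T * shift_sum k).

Lemma tr_symmetrizer (r : nat) (t : nat -> R) :
  (symmetrizer r t)^T = symmetrizer r t.
Proof.
rewrite /symmetrizer linear_sum; apply: eq_bigr => k _.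
by rewrite linearZ /= -mulmxE trmx_mul trmxK.
Qed.

Lemma dotv_symmetrizer (r : nat) (t : nat -> R) (w : 'cV[R]_n.+1) :
  dotv w (symmetrizer r t *m w) =
  \sum_(1 <= k < r.+1) t k * dotv (shift_sum k *m w) (shift_sum k *m w).
Proof.
rewrite /symmetrizer mulmx_suml dotv_sumr; apply: eq_bigr => k _.
by rewrite -scalemxAl dotvZr [in RHS]dotv_mulmxl mulmxA.
Qed.

Lemma symmetrizer_lower (r : nat) (t : nat -> R) (w : 'cV[R]_n.+1) :
  (0 < r)%N -> (forall k, (0 < k <= r)%N -> 0 < t k) ->
  t 1%N * dotv w w <= dotv w (symmetrizer r t *m w).
Proof.
move=> r0 t0; rewrite dotv_symmetrizer big_ltn //.
rewrite {1}/shift_sum {1}/shift_sum big_ord_recl big_ord0 addr0 expr0 mul1mx lerDl.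
rewrite big_nat sumr_ge0 // => k kr; rewrite mulr_ge0 ?dotv_ge0 // ltW // t0 //.
by lia.
Qed.

Lemma symmetrizer_upper (r : nat) (t : nat -> R) (w : 'cV[R]_n.+1) :
  (forall k, (0 < k <= r)%N -> 0 < t k) ->
  dotv w (symmetrizer r t *m w) <= (\sum_(1 <= k < r.+1) t k * k%:R ^+ 2) * dotv w w.
Proof.
move=> t0; rewrite dotv_symmetrizer mulr_suml big_nat [leRHS]big_nat.
apply: ler_sum => k kr; rewrite -mulrA ler_wpM2l ?dotv_shift_sum //.
by rewrite ltW // t0.
Qed.

(** Since alpha_nu is a tail sum of the t_k, exchanging the two summations groups
the powers of S occurring in G(S) into the telescoped blocks of
[shift_sum_telescope]. *)
Lemma HV_G_symmetrizer (s : nat) (alpha : int -> R) (t : nat -> R) :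
  (forall nu, (nu < cell_radius s)%N ->
     alpha nu = \sum_(nu.+1 <= k < (cell_radius s).+1) t k /\
     alpha (- 1 - nu%:Z) = - alpha nu) ->
  HV_G s alpha S = (1 - S^-1) * symmetrizer (cell_radius s) t.
Proof.
set r := cell_radius s => Ht.
have -> : HV_G s alpha S =
    \sum_(nu < r) alpha nu%:Z *: (S ^ nu%:Z - S ^ (- 1 - nu%:Z)).
  rewrite /HV_G big_split_ord /= (reindex_inj rev_ord_inj) /= -big_split /=.
  apply: eq_bigr => i _; have ir := ltn_ord i.
  have -> : cell_offset (lshift (cell_radius s) (rev_ord i)) = - 1 - i%:Z.
    by rewrite /cell_offset /= -/r; move: ir; rewrite -/r; lia.
  have -> : cell_offset (rshift (cell_radius s) i) = i%:Z.
    by rewrite /cell_offset /=; lia.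
  by rewrite (Ht _ ir).2 scaleNr scalerBr addrC.
rewrite /symmetrizer mulr_sumr.
under [RHS]eq_bigr do rewrite -scalerAr shift_sum_telescope scaler_sumr.
rewrite [RHS]big_nat.
under [RHS]eq_bigr => k kr.
  rewrite (big_ord_widen r (fun i => t k *: (S ^ i%:Z - S ^ (- 1 - i%:Z)))); last by lia.
  over.
rewrite -[RHS]big_nat (exchange_big_dep predT) //=.
apply: eq_bigr => i _; rewrite (Ht _ (ltn_ord i)).1 scaler_suml.
by rewrite (big_nat_widenl _ 1%N).
Qed.

Lemma tr_HV_H (s : nat) (beta : int -> R) :
  (forall k : nat, (k <= node_radius s)%N -> beta (- k%:Z) = - beta k) ->
  (HV_H s beta S)^T = - HV_H s beta S.
Proof.
set m := node_radius s => odd_beta.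
have oddz (j : int) : (`|j| <= m)%N -> beta (- j) = - beta j.
  case: (intP j) => [|k|k] jm; first exact: (odd_beta 0%N).
    exact: odd_beta.
  by rewrite opprK odd_beta ?opprK //; lia.
rewrite /HV_H linear_sum (reindex_inj rev_ord_inj) /= -sumrN.
apply: eq_bigr => i _; rewrite linearZ /= tr_cyclic_shift_exprz.
have -> : node_offset (rev_ord i) = - node_offset i.
  by rewrite /node_offset /= -/m; have := ltn_ord i; rewrite -/m; lia.
rewrite opprK oddz ?scaleNr //.
by rewrite /node_offset -/m; have := ltn_ord i; rewrite -/m; lia.
Qed.

End CyclicShift.

Definition energy_mx (R : realType) (n r : nat) (t : nat -> R) :
    'M[R]_(n.+1 + n.+1) :=
  block_mx (symmetrizer n r t) 0 0 1%:M.

Lemma tr_energy_mx (R : realType) (n r : nat) (t : nat -> R) :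
  (energy_mx n r t)^T = energy_mx n r t.
Proof. by rewrite /energy_mx tr_block_mx tr_symmetrizer !trmx0 trmx1. Qed.

Lemma dotv_energy_mx (R : realType) (n r : nat) (t : nat -> R)
    (w v : 'cV[R]_n.+1) :
  dotv (col_mx w v) (energy_mx n r t *m col_mx w v) =
  dotv w (symmetrizer n r t *m w) + dotv v v.
Proof. by rewrite mul_block_col !mul0mx addr0 add0r mul1mx dotv_col_mx. Qed.

(** The scheme is skew-symmetric for the energy: the coupling of the nodal values
into the cells and the coupling of the cells into the nodes are opposite
adjoints of each other once the cells are weighted by the symmetrizer. *)
Lemma HV_matrix_skew (R : realType) (s n : nat) (alpha beta : int -> R)
    (t : nat -> R) (x : 'cV[R]_(n.+1 + n.+1)) :
  HV_G s alpha (cyclic_shift R n) =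
    (1 - (cyclic_shift R n)^-1) * symmetrizer n (cell_radius s) t ->
  (HV_H s beta (cyclic_shift R n))^T = - HV_H s beta (cyclic_shift R n) ->
  dotv (HV_matrix s alpha beta n *m x) (energy_mx n (cell_radius s) t *m x) = 0.
Proof.
move=> GE HT; rewrite -[x]vsubmxK; set w := usubmx x; set v := dsubmx x.
rewrite !mul_block_col !mul0mx addr0 !add0r mul1mx dotv_col_mx dotvDl.
set Q := symmetrizer _ _ _; set S := cyclic_shift R n.
have -> : dotv ((S - 1) *m v) (Q *m w) = - dotv (HV_G s alpha S *m w) v.
  rewrite GE -/S -/Q -mulmxE -mulmxA [in RHS]dotvC [in LHS]dotv_mulmxl -dotvNr -mulNmx.
  by rewrite opprB linearB /= tr_cyclic_shift trmx1.
have HH : dotv (HV_H s beta S *m v) v = 0.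
  have := dotv_mulmxl (HV_H s beta S) v v.
  rewrite HT mulNmx dotvNr (dotvC v); lra.
by rewrite HH addr0 addNr.
Qed.

Theorem theorem5p3 (R : realType) (s : nat) (alpha beta : int -> R) :
  (1 <= s)%N -> optimally_accurate s alpha beta ->
  exists C : R, forall n : nat,
    (forall u : R -> 'cV[R]_(n.+1 + n.+1),
       semidiscrete_solution s alpha beta u ->
       forall t : R, 0 <= t -> dotv (u t) (u t) <= C * dotv (u 0) (u 0))
    /\
    (forall (t : nat -> R) (u : nat -> 'cV[R]_(n.+1 + n.+1)),
       (forall k : nat, 0 < t k.+1 - t k) ->
       midpoint_solution s alpha beta t u ->
       forall k : nat, (0 < k)%N ->
         dotv (u k) (u k) <= C * dotv (u 0%N) (u 0%N)).
Proof.
move=> s1 Hopt; have [r0 _ _] := stencil_radii s1.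
have [w w_gt0 Hw] := cell_weights s1 Hopt.
have beta_odd k := @node_weights_odd R s alpha beta k s1 Hopt.
set r := cell_radius s in r0 w_gt0 Hw.
pose lo : R := Num.min 1 (w 1%N).
pose hi : R := Num.max 1 (\sum_(1 <= k < r.+1) w k * k%:R ^+ 2).
have lo0 : 0 < lo by rewrite lt_min ltr01 w_gt0.
exists (hi / lo) => n.
pose P := energy_mx n r w.
have PT : P^T = P by exact: tr_energy_mx.
have skew x : dotv (HV_matrix s alpha beta n *m x) (P *m x) = 0.
  by apply: HV_matrix_skew; [exact: HV_G_symmetrizer|exact: tr_HV_H].
have lower x : lo * dotv x x <= dotv x (P *m x).
  rewrite -[x]vsubmxK dotv_energy_mx dotv_col_mx mulrDr lerD //.
    apply: le_trans (symmetrizer_lower _ r0 w_gt0).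
    by rewrite ler_wpM2r ?dotv_ge0 // ge_min lexx orbT.
  by rewrite ler_piMl ?dotv_ge0 // ge_min lexx.
have upper x : dotv x (P *m x) <= hi * dotv x x.
  rewrite -[x]vsubmxK dotv_energy_mx dotv_col_mx mulrDr lerD //.
    apply: le_trans (symmetrizer_upper _ w_gt0) _.
    by rewrite ler_wpM2r ?dotv_ge0 // le_max lexx orbT.
  by rewrite ler_peMl ?dotv_ge0 // le_max lexx.
have bound x y : dotv x (P *m x) = dotv y (P *m y) ->
    dotv x x <= hi / lo * dotv y y.
  move=> xy; rewrite mulrAC ler_pdivlMr // mulrC (le_trans (lower x)) //.
  by rewrite xy.
split=> [u [cu du] t t0|t u t_incr Hu k _]; apply: bound.
  exact: (flow_energy PT skew cu du).
elim: k => [//|k <-].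
by apply: (midpoint_energy PT skew) (Hu k); rewrite gt_eqF.
Qed.
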